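(* With probability one over the random channels the following holds for optimal solutions $(\phi,\{\mathbf{w}_{u,k}\})$ of $\mathcal{P}_{\mathrm{primal}}$ with corresponding optimal Lagrange multipliers $\{\mu_k\},\{\lambda_{u,k}/N_t\}$ (see the context). Partial zero-forcing beamforming at base station $k$ may be optimal only if $\mu_k=0$. If the optimal beamformer of some user in cell $k$ is partial zero-forcing, then the optimal beamformers of all users in cell $k$ are partial zero-forcing.
   Context: There are $L$ cells; base station (BS) $k$ has $N_t$ antennas and serves $U_k$ single-antenna users. The channel from BS $k$ to user $u$ of cell $j$ is a row vector $\mathbf{h}_{u,j,k}\in\mathbb{C}^{1\times N_t}$; all these vectors are independent and the entries of $\mathbf{h}_{u,j,k}$ are i.i.d. $\mathcal{CN}(0,\epsilon_{j,k})$ (zero-mean circularly symmetric complex Gaussian), $\epsilon_{j,k}>0$. Let $\sigma^2>0$, $P>0$ and target SINRs $\gamma_k>0$ be given. For beamforming vectors $\mathbf{w}_{u,k}\in\mathbb{C}^{N_t}$, $$\mathrm{SINR}_{u,k}=\frac{|\mathbf{h}_{u,k,k}\mathbf{w}_{u,k}|^2}{\sigma^2+\sum_{(u',j)\ne(u,k)}|\mathbf{h}_{u,k,j}\mathbf{w}_{u',j}|^2}.$$ $\mathcal{P}_{\mathrm{primal}}$: minimize $\phi\sum_{k=1}^LP$ over $\phi,\{\mathbf{w}_{u,k}\}$ subject to $\sum_{u=1}^{U_k}\|\mathbf{w}_{u,k}\|^2\le\phi P$ for all $k$, and $\mathrm{SINR}_{u,k}\ge\gamma_k$ for all $u,k$,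 where one may and does impose that $\mathbf{h}_{u,k,k}\mathbf{w}_{u,k}$ is real and strictly positive. The target SINRs are assumed achievable (with some finite power), so that Slater's condition holds for the equivalent convex (second-order cone) formulation, strong duality holds, and the KKT conditions are necessary and sufficient. The multiplier of the power constraint at BS $k$ is $\mu_k\ge0$, and $\lambda_{u,k}/N_t\ge0$ is the multiplier of the SINR constraint written as $\frac1{\gamma_k}|\mathbf{h}_{u,k,k}\mathbf{w}_{u,k}|^2\ge\sigma^2+\sum_{(\bar u,j)\ne(u,k)}|\mathbf{h}_{u,k,j}\mathbf{w}_{\bar u,j}|^2$. Put $$\boldsymbol\Sigma_{u,k}=\mu_k\mathbf{I}+\sum_{(\bar u,j)\ne(u,k)}\frac{\lambda_{\bar u,j}}{N_t}\mathbf{h}_{\bar u,j,k}^H\mathbf{h}_{\bar u,j,k}.$$ The KKT conditions are: stationarity $\left[\boldsymbol\Sigma_{u,k}-\frac{\lambda_{u,k}}{\gamma_kN_t}\mathbf{h}_{u,k,k}^H\mathbf{h}_{u,k,k}\right]\mathbf{w}_{u,k}=\mathbf{0}$ for all $u,k$ and $\sum_k(1-\mu_k)=0$; primal feasibility; $\mu_k,\lambda_{u,k}\ge0$; and complementary slackness for the power and SINR constraints. Definition. The optimal beamformer $\mathbf{w}_{u,k}$ is called partial zero-forcing if $\boldsymbol\Sigma_{u,k}$ is singular and $\mathbf{w}_{u,k}$ lies in its null space; this amounts to BS $k$ zero-forcing (i.e. $\mathbf{h}_{u',j,k}\mathbf{w}_{u,k}=0$) the users $(u',j)$ with $\lambda_{u',j}>0$.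 Partial zero-forcing beamforming at BS $k$ is optimal if this occurs for the optimal beamformers of users in cell $k$. *)

(* Defs.v *)
From HB Require Import structures.
From mathcomp Require Import all_boot all_order all_algebra.
From mathcomp Require Import complex.
From mathcomp Require Import all_classical all_reals all_analysis.

Set Implicit Arguments.
Unset Strict Implicit.
Unset Printing Implicit Defensive.

Import Order.TTheory GRing.Theory Num.Theory.
Import numFieldNormedType.Exports.

Local Open Scope classical_set_scope.
Local Open Scope ring_scope.
Local Open Scope complex_scope.
Local Open Scope sesquilinear_scope.

(* The pairs (u, k): user u of cell k is [Tagged _ u], and the cell of a user
   v is [tag v]. *)
Definition user (L : nat) (U : 'I_L -> nat) : finType := {k : 'I_L & 'I_(U k)}.

Section random_channel.
Context d (T : measurableType d) (R : realType) (Pr : probability T R).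

Definition mutually_independent (I : finType) d' (T' : measurableType d')
    (X : I -> T -> T') : Prop :=
  forall (J : {set I}) (B : I -> set T'), (forall i, measurable (B i)) ->
    Pr (\bigcap_(i in [set` J]) X i @^-1` B i)
    = (\prod_(i in J) Pr (X i @^-1` B i))%E.

(* R[i] and 'rV[R[i]]_n carry no measurable structure in the libraries; they
   are given the Borel structures of R * R and of tuples over R * R. *)
Definition complex_pair (z : R[i]) : R * R := (complex.Re z, complex.Im z).

Definition complex_coords n (x : 'rV[R[i]]_n) : n.-tuple (R * R) :=
  [tuple complex_pair (x 0 i) | i < n].

(* CN(0, e): the real and imaginary parts are independent N(0, e / 2); the
   scale argument of [normal_prob] is the standard deviation. *)
Definition circular_gaussian (Z : T -> R[i]) (e : R) : Prop :=
  let X t := complex.Re (Z t) in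
  let Y t := complex.Im (Z t) in
  let N := normal_prob 0 (Num.sqrt (e / 2)) in
  [/\ measurable_fun [set: T] X /\ measurable_fun [set: T] Y,
      forall A : set R, measurable A -> Pr (X @^-1` A) = N A,
      forall A : set R, measurable A -> Pr (Y @^-1` A) = N A &
      forall A B : set R, measurable A -> measurable B ->
        Pr (X @^-1` A `&` Y @^-1` B)
        = (Pr (X @^-1` A) * Pr (Y @^-1` B))%E].

(* [h t v k] is the channel from BS k to user v for the outcome t; [eps j k]
   is the variance for BS k and the users of cell j. *)
Definition rayleigh_channels (L Nt : nat) (U : 'I_L -> nat)
    (eps : 'I_L -> 'I_L -> R) (h : T -> user U -> 'I_L -> 'rV[R[i]]_Nt) :
    Prop :=
  [/\ forall v k i, circular_gaussian (fun t => h t v k 0 i) (eps (tag v) k),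
      forall v k,
        mutually_independent (fun i t => complex_pair (h t v k 0 i)) &
      mutually_independent
        (fun (vk : user U * 'I_L) t => complex_coords (h t vk.1 vk.2))].

End random_channel.

Section beamforming.
Context (R : realType) (L Nt : nat) (U : 'I_L -> nat).
Variables (sigma2 Pmax : R) (gamma : 'I_L -> R).
Variable h : user U -> 'I_L -> 'rV[R[i]]_Nt.

Implicit Types (phi : R) (w : user U -> 'cV[R[i]]_Nt).
Implicit Types (mu : 'I_L -> R) (lam : user U -> R) (k : 'I_L) (v : user U).

Definition sqnorm_c (z : R[i]) : R := ComplexField.Normc.normc z ^+ 2.

(* The amplitude at user v of the signal that BS (tag v') sends to v'. *)
Definition gain w v v' : R[i] := (h v (tag v') *m w v') 0 0.

Definition noise_interference w v : R :=
  sigma2 + \sum_(v' | v' != v) sqnorm_c (gain w v v').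

Definition SINR w v : R := sqnorm_c (gain w v v) / noise_interference w v.

Definition bs_power w k : R :=
  \sum_(u < U k) \sum_(i < Nt) sqnorm_c (w (Tagged _ u) i 0).

(* For z : R[i], 0 < z means that z is real and strictly positive. *)
Definition feasible phi w : Prop :=
  [/\ forall k, bs_power w k <= phi * Pmax,
      forall v, gamma (tag v) <= SINR w v &
      forall v, 0 < gain w v v].

Definition objective phi : R := phi * \sum_(k < L) Pmax.

Definition primal_optimal phi w : Prop :=
  feasible phi w /\
  forall phi' w', feasible phi' w' -> objective phi <= objective phi'.

(* h_(v,k)^H h_(v,k) *)
Definition channel_gram v k : 'M[R[i]]_Nt := (h v k) ^t* *m h v k.

Definition Sigma mu lam v : 'M[R[i]]_Nt :=
  ((mu (tag v))%:C)%:M +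
  \sum_(v' | v' != v) (lam v' / Nt%:R)%:C *: channel_gram v' (tag v).

(* The multipliers are mu k for the power constraint of BS k and lam v / Nt
   for the SINR constraint of user v. *)
Definition KKT phi w mu lam : Prop :=
  [/\ (forall v,
        (Sigma mu lam v
         - (lam v / (gamma (tag v) * Nt%:R))%:C *: channel_gram v (tag v))
        *m w v = 0)
      /\ \sum_(k < L) (1 - mu k) = 0,
      feasible phi w,
      (forall k, 0 <= mu k) /\ (forall v, 0 <= lam v),
      forall k, mu k * (bs_power w k - phi * Pmax) = 0 &
      forall v, lam v / Nt%:R *
        (noise_interference w v
         - (gamma (tag v))^-1 * sqnorm_c (gain w v v)) = 0].

Definition partial_zf w mu lam v : Prop :=
  Sigma mu lam v \notin unitmx /\ Sigma mu lam v *m w v = 0.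

Definition partial_zf_at w mu lam k : Prop :=
  forall u : 'I_(U k), partial_zf w mu lam (Tagged _ u).

End beamforming.

(* Main.v *)
(* A quadratic-form argument shows that a nonzero null vector x of
   Sigma_(v,k) forces mu_k = 0 and h_(v',k) x = 0 for every other user v' with a
   nonzero multiplier; beamformers are nonzero, so the first claim follows. If v
   is partially zero-forced, stationarity also gives lambda_v = 0, so w_v is
   killed by all the active channels seen from BS k, which hence do not span.
   Were another user v' of cell k active, stationarity would put h_(v',k) in the
   span of the remaining active channels. Almost surely this is impossible: a
   row y in the span of a non-spanning family satisfies
   y_j = y_g M^-1 c, where M is a maximal invertible minor of the family and j a
   column outside M, whereas y_j is atomless and independent of the right-hand
   side. *)

From HB Require Import structures.
Require Import Defs.
From mathcomp Require Import all_boot all_order all_algebra.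
From mathcomp Require Import complex.
From mathcomp Require Import all_classical all_reals all_analysis.
From mathcomp Require Import measurable_realfun.

Set Implicit Arguments.
Unset Strict Implicit.
Unset Printing Implicit Defensive.

Import Order.TTheory GRing.Theory Num.Theory.
Import numFieldNormedType.Exports.

Local Open Scope classical_set_scope.
Local Open Scope ring_scope.

(** * Independence and null sets *)

Section null_diagonal.
Context d (T : measurableType d) (R : realType) (Pr : probability T R).

(** By independence the joint law is the product of the two laws; by Fubini the diagonal then has as
    mass the integral of the probabilities that [Y] equals [x], which are all zero. *)
Lemma independent_neq_ae (X Y : T -> R) :
  measurable_fun [set: T] X -> measurable_fun [set: T] Y ->
  (forall A B, measurable A -> measurable B ->
    Pr (X @^-1` A `&` Y @^-1` B) = (Pr (X @^-1` A) * Pr (Y @^-1` B))%E) ->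
  (forall c, Pr (Y @^-1` [set c]) = 0%E) ->
  {ae Pr, forall t, X t <> Y t}.
Proof.
move=> mX mY indep atomless.
have mXY : measurable_fun [set: T] (fun t => (X t, Y t)).
  exact/measurable_fun_pair.
pose X' : {mfun T >-> R} := HB.pack X (isMeasurableFun.Build _ _ _ _ X mX).
pose Y' : {mfun T >-> R} := HB.pack Y (isMeasurableFun.Build _ _ _ _ Y mY).
pose XY : {mfun T >-> (R * R)%type} :=
  HB.pack (fun t => (X t, Y t)) (isMeasurableFun.Build _ _ _ _ _ mXY).
pose PX := distribution Pr X'; pose PY := distribution Pr Y'.
pose PXY := distribution Pr XY.
pose D : set (R * R) := [set p | p.1 = p.2].
have mD : measurable D.
  have -> : D = (fun p : R * R => p.1 - p.2) @^-1` [set 0].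
    apply/seteqP; split => p /=; first by move=> ->; rewrite subrr.
    by move/eqP; rewrite subr_eq0 => /eqP.
  rewrite -[X in measurable X]setTI.
  by apply: measurable_funB => //; exact: measurable_set1.
(* Independence is agreement on rectangles, which determines the product measure. *)
have DE : (PX \x PY)%E D = PXY D.
  exact: product_measure_unique.
have D0 : PXY D = 0%E.
  rewrite -DE /product_measure1; apply: integral0_eq => x _.
  rewrite /= (_ : xsection D x = [set x]).
    exact: atomless.
  apply/seteqP; split => y; rewrite /xsection /= inE /D /=; first by move=> ->.
  by move=> ->.
exists ((fun t => (X t, Y t)) @^-1` D); split.
- by have := mXY measurableT _ mD; rewrite setTI.
- exact: D0.
- by move=> t /=; rewrite notK.
Qed.

End null_diagonal.

Section sigma_independence.
Context d (T : measurableType d) (R : realType) (Pr : probability T R).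

(** As functions of [A], both sides are finite measures that agree on the pi-system [G], hence on
    the sigma-algebra it generates. *)
Lemma independent_g_sigma (G : set_system T) (E : set T) :
  G `<=` measurable -> setI_closed G -> G [set: T] -> measurable E ->
  (forall A, G A -> Pr (A `&` E) = (Pr A * Pr E)%E) ->
  forall A, <<s G >> A -> Pr (A `&` E) = (Pr A * Pr E)%E.
Proof.
move=> Gm GI GT mE indep A sA.
have PrE0 : 0 <= fine (Pr E) by rewrite fine_ge0.
pose m1 : {measure set T -> \bar R} := mrestr Pr mE.
pose m2 : {measure set T -> \bar R} := mscale (NngNum PrE0) Pr.
have m2E B : m2 B = (Pr B * Pr E)%E.
  by rewrite /m2 /= /mscale /= fineK ?fin_num_measure// muleC.
rewrite -m2E; apply: (g_sigma_algebra_measure_unique G Gm (fun=> [set: T])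
  (fun=> GT) _ m1 m2 GI) => //.
- by rewrite bigcup_const//; exists 0%N.
- by move=> B GB; rewrite m2E -indep.
- by move=> _; rewrite ltey_eq fin_num_measure.
Qed.

End sigma_independence.

(** * Measurability of complex-valued functions *)

Section complex_measurability.
Context d (T : measurableType d) (R : realType).
Implicit Types f g : T -> R[i].

(** Inversion is continuous away from zero, and any function is measurable on the remaining single
    point. *)
Lemma measurable_invr : measurable_fun [set: R] (@GRing.inv R).
Proof.
have -> : [set: R] = [set~ 0] `|` [set 0] by rewrite setUC setUCr.
apply/measurable_funU => //; first exact: measurableC.
split; last exact: measurable_fun_set1.
apply: open_continuous_measurable_fun.
  by apply: closed_openC; exact: closed_eq.
by move=> x; rewrite inE /= => /eqP x0; exact: inv_continuous.
Qed.

(** The domain is arbitrary, so that it may also carry the sigma-algebra generated by only some of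
    the channel coefficients. *)
Definition measurable_complex f : Prop :=
  measurable_fun [set: T] (fun t => complex.Re (f t)) /\
  measurable_fun [set: T] (fun t => complex.Im (f t)).

Lemma measurable_complex_cst c : measurable_complex (fun=> c).
Proof. by split; exact: measurable_cst. Qed.

Lemma measurable_complexD f g : measurable_complex f -> measurable_complex g ->
  measurable_complex (fun t => f t + g t).
Proof.
move=> [fR fI] [gR gI]; split.
  rewrite (_ : (fun _ => _) = (fun t => complex.Re (f t)) \+
    (fun t => complex.Re (g t))); first exact: measurable_funD.
  by apply/funext => t /=; case: (f t) (g t) => ? ? [].
rewrite (_ : (fun _ => _) = (fun t => complex.Im (f t)) \+
  (fun t => complex.Im (g t))); first exact: measurable_funD.
by apply/funext => t /=; case: (f t) (g t) => ? ? [].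
Qed.

Lemma measurable_complexM f g : measurable_complex f -> measurable_complex g ->
  measurable_complex (fun t => f t * g t).
Proof.
move=> [fR fI] [gR gI]; split.
  rewrite (_ : (fun _ => _) = fun t => complex.Re (f t) * complex.Re (g t) -
    complex.Im (f t) * complex.Im (g t)).
    by apply: measurable_funB; exact: measurable_funM.
  by apply/funext => t /=; case: (f t) (g t) => ? ? [].
rewrite (_ : (fun _ => _) = fun t => complex.Re (f t) * complex.Im (g t) +
  complex.Im (f t) * complex.Re (g t)).
  by apply: measurable_funD; exact: measurable_funM.
by apply/funext => t /=; case: (f t) (g t) => ? ? [].
Qed.

(** The inverse is the conjugate over the squared modulus, also at zero, where both are zero by
    convention. *)
Lemma measurable_complexV f : measurable_complex f ->
  measurable_complex (fun t => (f t)^-1).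
Proof.
move=> [fR fI].
have mn : measurable_fun [set: T] (fun t =>
    (complex.Re (f t) ^+ 2 + complex.Im (f t) ^+ 2)^-1).
  apply: (measurableT_comp measurable_invr).
  by apply: measurable_funD; exact: measurable_funX.
split.
  rewrite (_ : (fun _ => _) = fun t => complex.Re (f t) *
    (complex.Re (f t) ^+ 2 + complex.Im (f t) ^+ 2)^-1).
    exact: measurable_funM.
  by apply/funext => t /=; case: (f t).
rewrite (_ : (fun _ => _) = fun t => - (complex.Im (f t) *
  (complex.Re (f t) ^+ 2 + complex.Im (f t) ^+ 2)^-1)).
  by apply: measurable_funN; exact: measurable_funM.
by apply/funext => t /=; case: (f t).
Qed.

Lemma measurable_complex_sum (I : Type) (s : seq I) (F : I -> T -> R[i]) :
  (forall i, measurable_complex (F i)) ->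
  measurable_complex (fun t => \sum_(i <- s) F i t).
Proof.
move=> mF; elim: s => [|i s IHs].
  under eq_fun do rewrite big_nil; exact: measurable_complex_cst.
by under eq_fun do rewrite big_cons; exact: measurable_complexD.
Qed.

Lemma measurable_complex_prod (I : Type) (s : seq I) (F : I -> T -> R[i]) :
  (forall i, measurable_complex (F i)) ->
  measurable_complex (fun t => \prod_(i <- s) F i t).
Proof.
move=> mF; elim: s => [|i s IHs].
  under eq_fun do rewrite big_nil; exact: measurable_complex_cst.
by under eq_fun do rewrite big_cons; exact: measurable_complexM.
Qed.

Lemma measurable_complex_det n (M : T -> 'M[R[i]]_n) :
  (forall i j, measurable_complex (fun t => M t i j)) ->
  measurable_complex (fun t => \det (M t)).
Proof.
move=> mM; apply: measurable_complex_sum => s.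
apply: measurable_complexM; first exact: measurable_complex_cst.
exact: measurable_complex_prod.
Qed.

(** Cofactors are signed minors. With the determinant this handles inverse matrices by Cramer's
    formula. *)
Lemma measurable_complex_adj n (M : T -> 'M[R[i]]_n) i j :
  (forall i j, measurable_complex (fun t => M t i j)) ->
  measurable_complex (fun t => (\adj (M t)) i j).
Proof.
move=> mM; under eq_fun do rewrite mxE /cofactor.
apply: measurable_complexM; first exact: measurable_complex_cst.
apply: measurable_complex_det => a b.
by under eq_fun do rewrite !mxE; exact: mM.
Qed.

End complex_measurability.

(** * One coordinate against a function of all the others *)

Section independence.
Context d (T : measurableType d) (R : realType) (Pr : probability T R).

(** An event on entries is a box in each tuple; its probability factors first across the tuples,
    then inside each of them. *)
Lemma mutually_independent_tnth (I : finType) n d' (T' : measurableType d')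
    (X : I -> T -> n.-tuple T') :
  mutually_independent Pr X ->
  (forall i, mutually_independent Pr (fun j t => tnth (X i t) j)) ->
  mutually_independent Pr (fun (c : I * 'I_n) t => tnth (X c.1 t) c.2).
Proof.
move=> indepX indepXi J B mB.
(* Padding with full sets, which contribute factors 1, replaces [J] by the whole product index
   set. *)
pose B' c : set T' := if c \in J then B c else [set: T'].
have mB' c : measurable (B' c) by rewrite /B'; case: ifP.
pose C i := [set x : n.-tuple T' | forall j, B' (i, j) (tnth x j)].
have mC i : measurable (C i).
  rewrite (_ : C i =
      \bigcap_(j in [set: 'I_n]) (fun x => tnth x j) @^-1` B' (i, j)).
    apply: fin_bigcap_measurable => [|j _]; first exact: finite_finset.
    by rewrite -[X in measurable X]setTI; exact: measurable_tnth.
  by apply/seteqP; split => x /=; [move=> Cx j _|move=> Cx j]; exact: Cx.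
have -> : (\prod_(c in J) Pr ((fun t => tnth (X c.1 t) c.2) @^-1` B c) =
    \prod_i \prod_j Pr ((fun t => tnth (X i t) j) @^-1` B' (i, j)))%E.
  rewrite pair_bigA big_mkcond; apply: eq_bigr => -[i j] _ /=; rewrite /B'.
  by case: ifP => // _; rewrite preimage_setT probability_setT.
transitivity (Pr (\bigcap_(i in [set` finset.setT]) X i @^-1` C i)).
  congr (Pr _); apply/seteqP; split => t /= Ht.
    move=> i _ j; rewrite /B'; case: ifPn => // iJ.
    exact: (Ht (i, j) iJ).
  move=> [i j] iJ; have := Ht i (finset.in_setT i) j.
  by rewrite /B' (iJ : _ \in J).
rewrite indepX//; apply: eq_big => i; first by rewrite inE.
move=> _; have := indepXi i finset.setT (fun j => B' (i, j)) (fun j => mB' _).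
rewrite (eq_bigl predT) => [<-|j]; last by rewrite inE.
congr (Pr _); apply/seteqP; split => t /= Ht; first by move=> j _; exact: Ht.
by move=> j; apply: Ht; rewrite /= inE.
Qed.

Section coordinates.
Variables (I : finType) (Z : I -> T -> R[i]).
Hypothesis mZ : forall i, measurable_complex (Z i).
Hypothesis indepZ : mutually_independent Pr (fun i t => complex_pair (Z i t)).

(* A pi-system generating the sigma-algebra of all the coordinates but i0. *)
Definition others_cylinders (i0 : I) : set_system T :=
  [set A | exists2 D : I -> set (R * R), (forall i, measurable (D i)) &
    A = \bigcap_(i in [set` [set~ i0]%SET])
      (fun t => complex_pair (Z i t)) @^-1` D i].

Lemma measurable_complex_pair i :
  measurable_fun [set: T] (fun t => complex_pair (Z i t)).
Proof. by have [mR mI] := mZ i; exact/measurable_fun_pair. Qed.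

Lemma others_cylinders_measurable i0 : others_cylinders i0 `<=` measurable.
Proof.
move=> _ [D mD ->]; apply: fin_bigcap_measurable => [|i _].
  exact: finite_finset.
rewrite -[X in measurable X]setTI; exact: measurable_complex_pair.
Qed.

Lemma others_cylinders_setI i0 : setI_closed (others_cylinders i0).
Proof.
move=> _ _ [D mD ->] [E mE ->]; exists (fun i => D i `&` E i).
  by move=> i; exact: measurableI.
by rewrite -bigcapI.
Qed.

Lemma others_cylinders_setT i0 : others_cylinders i0 [set: T].
Proof. by exists (fun=> [set: R * R]) => //; rewrite bigcapT. Qed.

Lemma others_cylinders_preimage i0 i (B : set (R * R)) :
  i != i0 -> measurable B ->
  others_cylinders i0 ((fun t => complex_pair (Z i t)) @^-1` B).
Proof.
move=> ii0 mB; exists (fun i' => if i' == i then B else [set: R * R]).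
  by move=> i'; case: ifP.
apply/seteqP; split => t /= Bt; first by move=> i' _; case: eqVneq => [->|].
by have := Bt i; rewrite /= eqxx; apply; rewrite finset.in_setC1.
Qed.

(** Independence is used for all indices and for all but [i0]; the two product formulas differ by
    the factor of [i0]. *)
Lemma others_cylinders_independent i0 A (B : set (R * R)) : measurable B ->
  others_cylinders i0 A ->
  let E := (fun t => complex_pair (Z i0 t)) @^-1` B in
  Pr (A `&` E) = (Pr A * Pr E)%E.
Proof.
move=> mB [D mD ->] /=.
pose D' i := if i == i0 then B else D i.
have mD' i : measurable (D' i) by rewrite /D'; case: ifP.
have := indepZ finset.setT mD'; rewrite (bigD1 i0)//= {2}/D' eqxx.
rewrite (indepZ [set~ i0]%SET mD) muleC => EE.
transitivity (Pr (\bigcap_(i in [set` finset.setT])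
    (fun t => complex_pair (Z i t)) @^-1` D' i)).
  congr (Pr _); apply/seteqP; split => t /=.
    move=> [At Et] i _; rewrite /D' /=; case: eqVneq => [->//|ii0].
    by apply: At; rewrite /= finset.in_setC1.
  move=> Ht; split; last first.
    by have := Ht i0 (finset.in_setT i0); rewrite /D' /= eqxx.
  move=> i /=; rewrite finset.in_setC1 => /negPf ii0.
  by have := Ht i (finset.in_setT i); rewrite /D' /= ii0.
rewrite EE; congr (_ * _)%E; apply: eq_big => i; first by rewrite !inE.
by rewrite /D' !inE => /negPf ->.
Qed.

Lemma measurable_complex_others i0 i : i != i0 ->
  measurable_complex (Z i : g_sigma_algebraType (others_cylinders i0) -> R[i]).
Proof.
move=> ii0; split => _ B mB; rewrite setTI; apply: sub_sigma_algebra.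
  have := others_cylinders_preimage ii0 (measurableX mB measurableT).
  congr (others_cylinders _ _).
  by apply/seteqP; split => t /=; [case|].
have := others_cylinders_preimage ii0 (measurableX measurableT mB).
congr (others_cylinders _ _).
by apply/seteqP; split => t /=; [case|].
Qed.

(** The real parts already differ almost surely: that of [F] depends on the other coordinates only,
    so it is independent of the atomless real part of [Z i0]. *)
Lemma coordinate_neq_ae i0 (F : T -> R[i]) :
  measurable_complex (F : g_sigma_algebraType (others_cylinders i0) -> R[i]) ->
  (forall c, Pr ((fun t => complex.Re (Z i0 t)) @^-1` [set c]) = 0%E) ->
  {ae Pr, forall t, Z i0 t <> F t}.
Proof.
move=> [mF _] atomless.
have sub A : <<s others_cylinders i0 >> A -> measurable A.
  apply: smallest_sub; last exact: others_cylinders_measurable.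
  exact: sigma_algebra_measurable.
have : {ae Pr, forall t, complex.Re (F t) <> complex.Re (Z i0 t)}.
  apply: independent_neq_ae => //.
  - by move=> _ B mB; apply: sub; exact: mF measurableT _ mB.
  - by have [] := mZ i0.
  - move=> A B mA mB.
    have -> : (fun t => complex.Re (Z i0 t)) @^-1` B =
        (fun t => complex_pair (Z i0 t)) @^-1` (B `*` [set: R]).
      by apply/seteqP; split => t /=; [|case].
    apply: (independent_g_sigma (@others_cylinders_measurable i0)
      (@others_cylinders_setI i0) (@others_cylinders_setT i0)).
    + rewrite -[X in measurable X]setTI; apply: measurable_complex_pair => //.
      exact: measurableX.
    + move=> A' GA'; apply: others_cylinders_independent => //.
      exact: measurableX.
    + by have := mF measurableT _ mA; rewrite setTI.
by apply: filterS => t + ZF; apply; rewrite ZF.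
Qed.

End coordinates.

End independence.

(** * Partial zero-forcing at a KKT point *)

Section kkt.
Local Open Scope complex_scope.
Local Open Scope sesquilinear_scope.
Context (R : realType) (L Nt : nat) (U : 'I_L -> nat).
Variables (sigma2 Pmax : R) (gamma : 'I_L -> R).
Variable h : user U -> 'I_L -> 'rV[R[i]]_Nt.

Implicit Types (phi : R) (w : user U -> 'cV[R[i]]_Nt) (x y : 'cV[R[i]]_Nt).
Implicit Types (mu : 'I_L -> R) (lam : user U -> R) (k : 'I_L) (v : user U).

(* No h_(v,k) lies in the span of a non-spanning family of other channels, a
   family being tested against the vectors x that it annihilates. *)
Definition generic_channels : Prop :=
  forall k v (B : {set user U}), v \notin B ->
    (exists2 x : 'cV_Nt, x != 0 & forall b, b \in B -> h b k *m x = 0) ->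
    exists2 x : 'cV_Nt, (forall b, b \in B -> h b k *m x = 0) & h v k *m x != 0.

Lemma dotc_gram v k x y :
  x ^t* *m (channel_gram h v k *m y) = (h v k *m x) ^t* *m (h v k *m y).
Proof. by rewrite /channel_gram trmx_mul map_mxM !mulmxA. Qed.

Lemma dotc_ge0 n (x : 'cV[R[i]]_n) : 0 <= (x ^t* *m x) 0 0.
Proof.
by rewrite mxE; apply: sumr_ge0 => i _; rewrite !mxE mulrC mul_conjC_ge0.
Qed.

Lemma dotc_eq0 n (x : 'cV[R[i]]_n) : (x ^t* *m x) 0 0 = 0 -> x = 0.
Proof.
have F0 i : 0 <= (x ^t* ) 0 i * x i 0 by rewrite !mxE mulrC mul_conjC_ge0.
rewrite mxE => /(psumr_eq0P (fun i _ => F0 i)) x0; apply/colP => i.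
by apply/eqP; have /eqP := x0 i isT; rewrite !mxE mulrC mul_conjC_eq0.
Qed.

Lemma dotc_scalar_eq0 (a b : 'M[R[i]]_1) :
  (a ^t* *m b == 0) = (a == 0) || (b == 0).
Proof.
have mx11_eq0 (c : 'M[R[i]]_1) : (c == 0) = (c 0 0 == 0).
  apply/eqP/eqP => [->|c0]; first by rewrite mxE.
  by apply/matrixP => i j; rewrite !ord1 c0 mxE.
by rewrite !mx11_eq0 mxE big_ord1 !mxE mulf_eq0 conjC_eq0.
Qed.

(** Taken at [y = x] this is a sum of nonnegative terms; taken at distinct vectors it pairs
    stationarity with a test vector. *)
Lemma dotc_Sigma mu lam v x y :
  x ^t* *m (Sigma h mu lam v *m y) =
  (mu (tag v))%:C *: (x ^t* *m y) +
  \sum_(v' | v' != v) (lam v' / Nt%:R)%:C *: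
    ((h v' (tag v) *m x) ^t* *m (h v' (tag v) *m y)).
Proof.
rewrite /Sigma mulmxDl mulmxDr mul_scalar_mx -scalemxAr; congr (_ + _).
rewrite mulmx_suml mulmx_sumr; apply: eq_bigr => v' _.
by rewrite -scalemxAl -scalemxAr dotc_gram.
Qed.

Lemma Sigma_null mu lam v x :
  (0 < Nt)%N -> (forall k, 0 <= mu k) -> (forall v, 0 <= lam v) ->
  Sigma h mu lam v *m x = 0 -> x != 0 ->
  mu (tag v) = 0 /\
  forall v', v' != v -> lam v' != 0 -> h v' (tag v) *m x = 0.
Proof.
move=> Nt0 mu0 lam0 Sx x0.
have := dotc_Sigma mu lam v x x; rewrite Sx mulmx0 => /esym/matrixP/(_ 0 0).
rewrite mxE [in RHS]mxE [X in X + _]mxE summxE => /eqP.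
have ge0 v' : v' != v -> 0 <= ((lam v' / Nt%:R)%:C *:
    ((h v' (tag v) *m x) ^t* *m (h v' (tag v) *m x))) 0 0.
  by rewrite [X in 0 <= X]mxE => _; rewrite mulr_ge0 ?dotc_ge0// lecR divr_ge0.
rewrite paddr_eq0; last 2 first.
- by rewrite mulr_ge0 ?lecR// ?dotc_ge0.
- exact: sumr_ge0.
move=> /andP[mu_eq0 /eqP lam_eq0]; split.
  move: mu_eq0; rewrite mulf_eq0 fmorph_eq0 => /orP[/eqP //|/eqP xx0].
  by case/eqP: x0; exact: dotc_eq0.
move=> v' v'v lamv'; have /eqP := psumr_eq0P ge0 lam_eq0 v'v.
rewrite mxE mulf_eq0 fmorph_eq0 => /orP[|/eqP /dotc_eq0//].
by rewrite mulf_eq0 (negPf lamv') invr_eq0 pnatr_eq0 -leqn0 leqNgt Nt0.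
Qed.

Lemma Sigma_null_converse mu lam v x : mu (tag v) = 0 ->
  (forall v', v' != v -> lam v' != 0 -> h v' (tag v) *m x = 0) ->
  Sigma h mu lam v *m x = 0.
Proof.
move=> mu0 hx; rewrite /Sigma mu0 mulmxDl mul_scalar_mx scale0r add0r.
rewrite mulmx_suml big1// => v' v'v; have [->|lamv'] := eqVneq (lam v') 0.
  by rewrite mul0r scale0r mul0mx.
by rewrite -scalemxAl /channel_gram -mulmxA hx// mulmx0 scaler0.
Qed.

Section kkt_point.
Variables (phi : R) (w : user U -> 'cV[R[i]]_Nt).
Variables (mu : 'I_L -> R) (lam : user U -> R).
Hypothesis Nt_gt0 : (0 < Nt)%N.
Hypothesis gamma_gt0 : forall k, 0 < gamma k.
Hypothesis kkt : KKT sigma2 Pmax gamma h phi w mu lam.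

Lemma KKT_gain_neq0 v : h v (tag v) *m w v != 0.
Proof.
have [_ [_ _ /(_ v) + ] _ _ _] := kkt.
by rewrite /gain; apply: contraTneq => ->; rewrite mxE ltxx.
Qed.

Lemma KKT_beamformer_neq0 v : w v != 0.
Proof. by apply: contra_neq (KKT_gain_neq0 v) => ->; rewrite mulmx0. Qed.

Lemma KKT_Sigma v :
  Sigma h mu lam v *m w v = (lam v / (gamma (tag v) * Nt%:R))%:C *:
    (channel_gram h v (tag v) *m w v).
Proof.
have [[/(_ v) + _] _ _ _ _] := kkt.
by rewrite mulmxBl -scalemxAl => /eqP; rewrite subr_eq0 => /eqP.
Qed.

(** Pairing stationarity with [w v] leaves a positive multiple of [lam v] times the squared modulus
    of a nonzero gain. *)
Lemma KKT_partial_zf_lam v : partial_zf h w mu lam v -> lam v = 0.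
Proof.
move=> [_ Sw0]; have := KKT_Sigma v; rewrite Sw0 => /esym.
move=> /(congr1 (mulmx ((w v) ^t* ))); rewrite mulmx0 -scalemxAr dotc_gram.
move=> /eqP; rewrite scaler_eq0 fmorph_eq0 => /orP[|].
  rewrite mulf_eq0 invr_eq0 mulf_eq0 pnatr_eq0 eqn0Ngt Nt_gt0 orbF.
  by rewrite (gt_eqF (gamma_gt0 _)) orbF => /eqP.
by rewrite dotc_scalar_eq0 (negPf (KKT_gain_neq0 v)).
Qed.

Lemma KKT_partial_zf_mu v : partial_zf h w mu lam v -> mu (tag v) = 0.
Proof.
have [_ _ [mu0 lam0] _ _] := kkt.
move=> [_ Sw0].
by have [] := Sigma_null Nt_gt0 mu0 lam0 Sw0 (KKT_beamformer_neq0 v).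
Qed.

Lemma KKT_partial_zf_cell v v' : generic_channels -> tag v' = tag v ->
  partial_zf h w mu lam v -> partial_zf h w mu lam v'.
Proof.
move=> generic tagv' zfv; have lamv := KKT_partial_zf_lam zfv.
have [_ _ [mu0 lam0] _ _] := kkt.
have w0 := KKT_beamformer_neq0 v.
have [muv hw] := Sigma_null Nt_gt0 mu0 lam0 zfv.2 w0.
(* The exception [b = v] disappears because [lam v = 0]. *)
have {}hw b : lam b != 0 -> h b (tag v') *m w v = 0.
  move=> lamb; rewrite tagv' hw//.
  by apply: contra_neq lamb => ->.
have muv' : mu (tag v') = 0 by rewrite tagv'.
split.
  (* The nonzero vector [w v] is also a null vector of the matrix of [v']. *)
  apply: contra_neqN w0 => Sunit; rewrite -[w v](mulKmx Sunit).
  by rewrite Sigma_null_converse ?mulmx0// => b _; exact: hw.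
rewrite KKT_Sigma; have [->|lamv'] := eqVneq (lam v') 0.
  by rewrite mul0r scale0r.
(* If [v'] were active, [w v] would show that the other active channels do not span; genericity then
   yields [x] that they annihilate but the channel of [v'] does not. *)
have [||x hx] := generic (tag v') v'
  (finset (fun b => (b != v') && (lam b != 0))).
- by rewrite inE eqxx.
- by exists (w v) => // b; rewrite inE => /andP[_]; exact: hw.
(* Paired with [x], the left side of stationarity for [v'] vanishes, while the right side is a
   product of nonzero factors. *)
case/negP; have := congr1 (mulmx (x ^t* )) (KKT_Sigma v').
rewrite dotc_Sigma muv' scale0r add0r big1; last first.
  move=> b bv'; have [->|lamb] := eqVneq (lam b) 0.
    by rewrite mul0r scale0r.
  by rewrite hx ?inE ?bv'// trmx0 map_mx0 mul0mx scaler0.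
rewrite -scalemxAr dotc_gram => /esym/eqP.
rewrite scaler_eq0 fmorph_eq0 => /orP[|].
  rewrite mulf_eq0 invr_eq0 mulf_eq0 pnatr_eq0 eqn0Ngt Nt_gt0 orbF.
  by rewrite (gt_eqF (gamma_gt0 _)) orbF (negPf lamv').
by rewrite dotc_scalar_eq0 (negPf (KKT_gain_neq0 v')) orbF.
Qed.

End kkt_point.
End kkt.

(** * Genericity of Rayleigh channels *)

(** With [y = z A1] for a row basis [A1] of [A], the columns [g] determine [z] through the
    invertible minor, and [z] determines the entry [j]. *)
Lemma submx_bordered_minor (F : fieldType) m n (A : 'M[F]_(m, n)) (y : 'rV_n) :
  (y <= A)%MS -> ~~ row_full A ->
  exists r (f : {ffun 'I_r -> 'I_m}) (g : {ffun 'I_r -> 'I_n}) (j : 'I_n),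
    [/\ forall b, g b != j, mxsub f g A \in unitmx &
        y 0 j = (colsub g y *m (invmx (mxsub f g A) *m
                  \col_a A (f a) j)) 0 0].
Proof.
move=> yA nfull.
pose f := maxrankfun A; pose A1 := rowsub f A.
have A1free : row_free A1 := maxrowsub_free A.
have fullA1 : row_full A1^T by rewrite /row_full mxrank_tr.
pose g := fullrankfun fullA1.
have gunit : mxsub f g A \in unitmx.
  rewrite -unitmx_tr (_ : _^T = rowsub g A1^T) ?fullrowsub_unit//.
  by apply/matrixP => a b; rewrite !mxE.
have [j gj] : exists j, forall b, g b != j.
  (* Pigeonhole: [g] picks as many columns as the rank of [A], which is less than [n]. *)
  have /existsP[j Hj] : [exists j, j \notin codom g].
    rewrite -negb_forall; apply/negP => /forallP full.
    have : (#|'I_n| <= #|codom g|)%N.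
      by apply/subset_leq_card/fintype.subsetP => j _.
    move=> /leq_trans /(_ (card_size _)); rewrite size_codom !card_ord.
    by rewrite leqNgt ltn_neqAle rank_leq_col andbT nfull.
  by exists j => b; apply: contra Hj => /eqP <-; exact: codom_f.
exists (\rank A), f, g, j; split => //.
have /submxP[z yE] : (y <= A1)%MS by rewrite eq_maxrowsub.
have -> : colsub g y = z *m mxsub f g A.
  rewrite yE -mulmx_colsub; congr (_ *m _).
  by apply/matrixP => a b; rewrite !mxE.
rewrite -mulmxA (mulmxA _ (invmx _)) mulmxV// mul1mx yE !mxE.
by apply: eq_bigr => a _; rewrite !mxE.
Qed.

Section rayleigh.
Context d (T : measurableType d) (R : realType) (Pr : probability T R).
Variables (L Nt : nat) (U : 'I_L -> nat) (eps : 'I_L -> 'I_L -> R).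
Variable h : T -> user U -> 'I_L -> 'rV[R[i]]_Nt.
Hypothesis h_rayleigh : rayleigh_channels Pr eps h.

(** A single family of scalars, so that isolating one entry leaves the rest of its own row among the
    independent others. *)
Let coord (c : (user U * 'I_L) * 'I_Nt) t : R[i] := h t c.1.1 c.1.2 0 c.2.

Lemma rayleigh_independent :
  mutually_independent Pr (fun c t => complex_pair (coord c t)).
Proof.
have [_ indep_entries indep_channels] := h_rayleigh.
have coordsE v k : (fun j t => tnth (complex_coords (h t v k)) j) =
    (fun j t => complex_pair (h t v k 0 j)).
  by apply/funext => j; apply/funext => t; rewrite tnth_mktuple.
have := mutually_independent_tnth indep_channels.
rewrite (_ : (fun _ _ => _) = fun c t => complex_pair (coord c t)); last first.
  by apply/funext => c; apply/funext => t; rewrite tnth_mktuple.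
by apply => -[v k]; rewrite coordsE; exact: indep_entries.
Qed.

Lemma rayleigh_measurable c : measurable_complex (coord c).
Proof. by have [/(_ c.1.1 c.1.2 c.2) []] := h_rayleigh. Qed.

(** Normal laws are absolutely continuous with respect to Lebesgue measure. *)
Lemma rayleigh_atomless c r :
  Pr ((fun t => complex.Re (coord c t)) @^-1` [set r]) = 0%E.
Proof.
have [/(_ c.1.1 c.1.2 c.2) [_ -> // _ _] _ _] := h_rayleigh.
move/null_content_dominatesP: (@normal_prob_dominates R 0
  (Num.sqrt (eps (tag c.1.1) c.1.2 / 2))); apply => //.
exact: lebesgue_measure_set1.
Qed.

(** Since [f] avoids [v] and [g] avoids [j], the right-hand side involves only coefficients other
    than the isolated one. *)
Lemma rayleigh_minor_ae k v r (f : {ffun 'I_r -> user U})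
    (g : {ffun 'I_r -> 'I_Nt}) (j : 'I_Nt) :
  (forall a, f a != v) -> (forall b, g b != j) ->
  {ae Pr, forall t, let M := \matrix_(a, b) h t (f a) k 0 (g b) in
    M \in unitmx -> h t v k 0 j <> (colsub g (h t v k) *m
      (invmx M *m \col_a h t (f a) k 0 j)) 0 0}.
Proof.
move=> fv gj; pose M t : 'M[R[i]]_r := \matrix_(a, b) h t (f a) k 0 (g b).
(* The adjugate formula makes [F] measurable for all outcomes; it agrees with the [invmx] expression
   where [M t] is invertible. *)
pose F t : R[i] := \sum_b h t v k 0 (g b) *
  \sum_a ((\det (M t))^-1 * (\adj (M t)) b a) * h t (f a) k 0 j.
pose c0 := ((v, k), j).
pose T0 := g_sigma_algebraType (others_cylinders coord c0).
have mcoord v' j' : (v', j') != (v, j) -> measurable_complex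
    ((fun t => h t v' k 0 j') : T0 -> R[i]).
  move=> ne; apply: (@measurable_complex_others _ _ _ _ coord c0 ((v', k), j')).
  by apply: contra ne => /eqP[-> ->].
have mM a b : measurable_complex
    ((fun t => M t a b) : T0 -> R[i]).
  under eq_fun do rewrite mxE.
  by apply: mcoord; rewrite xpair_eqE negb_and fv.
have : {ae Pr, forall t, coord c0 t <> F t}.
  apply: coordinate_neq_ae.
  - exact: rayleigh_measurable.
  - exact: rayleigh_independent.
  - apply: measurable_complex_sum => b; apply: measurable_complexM.
      by apply: mcoord; rewrite xpair_eqE negb_and gj orbT.
    apply: measurable_complex_sum => a; apply: measurable_complexM.
      apply: measurable_complexM; last exact: measurable_complex_adj.
      exact/measurable_complexV/measurable_complex_det.
    by apply: mcoord; rewrite xpair_eqE negb_and fv.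
  - exact: rayleigh_atomless.
apply: filterS => t neqF /= Munit eqF; apply: neqF; rewrite /coord /= {}eqF mxE.
apply: eq_bigr => b _; rewrite !mxE; congr (_ * _); apply: eq_bigr => a _.
by rewrite /invmx Munit !mxE.
Qed.

Lemma rayleigh_generic_ae : {ae Pr, forall t, generic_channels (h t)}.
Proof.
(* One null set serves all minors: [r] is a natural number and the other data range over a finite
   type. *)
have : {ae Pr, forall t, forall r (p : 'I_L * user U *
    {ffun 'I_r -> user U} * {ffun 'I_r -> 'I_Nt} * 'I_Nt),
    let: (k, v, f, g, j) := p in
    (forall a, f a != v) -> (forall b, g b != j) ->
    let M := \matrix_(a, b) h t (f a) k 0 (g b) in
    M \in unitmx -> h t v k 0 j <> (colsub g (h t v k) *m
      (invmx M *m \col_a h t (f a) k 0 j)) 0 0}.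
  apply: ae_foralln => r; apply: filter_forall => -[[[[k v] f] g] j].
  have [fv|nfv] := pselect (forall a, f a != v); last by apply: aeW => t /nfv.
  have [gj|ngj] := pselect (forall b, g b != j); last first.
    by apply: aeW => t _ /ngj.
  by apply: filterS (rayleigh_minor_ae k fv gj) => t H _ _.
apply: filterS => t minors k v B vB [x x0 Bx].
apply: contrapT => nex.
(* The negation of genericity: whatever [B] annihilates, [v] annihilates too. *)
have killed (y : 'cV[R[i]]_Nt) :
    (forall b, b \in B -> h t b k *m y = 0) -> h t v k *m y = 0.
  move=> By; apply/eqP; apply: contrapT => /negP vy.
  by apply: nex; exists y.
pose A := \matrix_(i < #|B|) h t (enum_val i) k.
have AP p (Y : 'M[R[i]]_(Nt, p)) :
    A *m Y = 0 <-> forall b, b \in B -> h t b k *m Y = 0.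
  split => [AY b bB|BY].
    rewrite -(enum_rankK_in bB bB).
    rewrite -[h _ _ _](rowK (fun i => h t (enum_val i) k)).
    by rewrite -row_mul AY row0.
  by apply/row_matrixP => i; rewrite row_mul rowK row0 BY// enum_valP.
(* The columns of the cokernel of [A] are annihilated by [B], hence by the channel of [v], which
   thus lies in the row space. *)
have vA : (h t v k <= A)%MS.
  rewrite submxE; apply/eqP/trmx_inj/row_matrixP => i.
  rewrite trmx0 row0 -tr_col colE -mulmxA (killed (cokermx A *m _)) ?trmx0//.
  by apply/AP; rewrite mulmxA mulmx_coker mul0mx.
(* A left inverse of [A] would force [x = 0]. *)
have Anfull : ~~ row_full A.
  apply: contra x0 => /row_fullP[V VA]; rewrite -[x]mul1mx -VA -mulmxA.
  by rewrite (AP _ x).2// mulmx0.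
have [r [f [g [j [gj Munit]]]]] := submx_bordered_minor vA Anfull.
have := minors r (k, v, [ffun a => enum_val (f a)], g, j) _ gj.
rewrite (_ : (\matrix_(a, b) _) = mxsub f g A); last first.
  by apply/matrixP => a b; rewrite !mxE ffunE.
rewrite (_ : (\col_a _) = \col_a A (f a) j); last first.
  by apply/matrixP => a b; rewrite !mxE ffunE.
(* The rows of the minor belong to users in [B], so none is [v]. *)
apply => // a; rewrite ffunE; apply: contraNneq vB => <-; exact: enum_valP.
Qed.

End rayleigh.

Theorem corollary1 (R : realType) (d : measure_display) (T : measurableType d)
    (Pr : probability T R) (L Nt : nat) (U : 'I_L -> nat)
    (eps : 'I_L -> 'I_L -> R) (sigma2 Pmax : R) (gamma : 'I_L -> R)
    (h : T -> user U -> 'I_L -> 'rV[R[i]]_Nt)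
    (Nt_gt0 : (0 < Nt)%N) (U_gt0 : forall k, (0 < U k)%N)
    (eps_gt0 : forall j k, 0 < eps j k)
    (sigma2_gt0 : 0 < sigma2) (Pmax_gt0 : 0 < Pmax)
    (gamma_gt0 : forall k, 0 < gamma k)
    (h_rayleigh : rayleigh_channels Pr eps h) :
  {ae Pr, forall t : T,
    forall (phi : R) (w : user U -> 'cV[R[i]]_Nt)
           (mu : 'I_L -> R) (lam : user U -> R),
      primal_optimal sigma2 Pmax gamma (h t) phi w ->
      KKT sigma2 Pmax gamma (h t) phi w mu lam ->
      forall k : 'I_L,
        (partial_zf_at (h t) w mu lam k -> mu k = 0) /\
        ((exists u : 'I_(U k), partial_zf (h t) w mu lam (Tagged _ u)) ->
         forall u : 'I_(U k), partial_zf (h t) w mu lam (Tagged _ u))}.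
Proof.
apply: filterS (rayleigh_generic_ae h_rayleigh).
move=> t generic phi w mu lam _ kkt k.
split=> [zf|[u zfu] u'].
  (* For an empty cell [zf] would be vacuous; [U_gt0] provides a user to apply it to. *)
  exact: (KKT_partial_zf_mu Nt_gt0 kkt (zf (Ordinal (U_gt0 k)))).
exact: (KKT_partial_zf_cell Nt_gt0 gamma_gt0 kkt generic _ zfu).
Qed.
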